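(* Let $X$ be reflexive and assume that for all sequences $\{x^k\}\subset C$ and all $x\in C$ the following implication holds: $$x^k\rightharpoonup x\quad\text{and}\quad d_K(G(x^k))\to 0\quad\Longrightarrow\quad G(x)\in K .$$ Then w-, sw-, and s-AKKT regularity are constraint qualifications for the problem $(P)$: minimize $f(x)$ over $x\in C$ subject to $G(x)\in K$, in the following sense: if $\bar x\in\mathcal F$ is w-AKKT regular, sw-AKKT regular, or s-AKKT regular, then for every objective $f\colon X\to\mathbb R$ which is continuously differentiable and weakly sequentially lower semicontinuous, local optimality of $\bar x$ for $(P)$ implies that $\bar x$ is a KKT point of $(P)$.
   Context: Setting: $X$ and $Y$ are real Banach spaces, $G\colon X\to Y$ is continuously Fréchet differentiable, $C\subset X$ and $K\subset Y$ are nonempty, closed, convex sets, $\mathcal F:=\{x\in C\mid G(x)\in K\}$. $d_K(y)=\inf_{z\in K}\|y-z\|_Y$; $\rightharpoonup$, $\rightharpoonup^*$ denote weak and weak* convergence of sequences. For a closed convex set $S$, $\mathcal N_S(x):=\{v\mid\langle v,z-x\rangle\le0\ \forall z\in S\}$ (in the dual space) for $x\in S$, $\mathcal N_S(x):=\varnothing$ otherwise. $\bar x\in\mathcal F$ is a KKT point of $(P)$ if there is $\bar\lambda\in Y^*$ with $-f'(\bar x)-G'(\bar x)^*\bar\lambda\in\mathcal N_C(\bar x)$ and $\bar\lambda\in\mathcal N_K(G(\bar x))$. For $x\in X$ and $r\ge0$ let $$\mathcal M(x,r):=\{G'(x)^*\lambda+\mu\in X^*\mid \lambda\in Y^*,\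 \mu\in\mathcal N_C(x),\ \langle\lambda,y-G(x)\rangle_Y\le r\ \forall y\in K\}.$$ A point $\bar x\in\mathcal F$ is s-AKKT regular if every $\bar v\in X^*$ for which there exist sequences $\{x^k\}\subset X$, $\{r^k\}\subset[0,+\infty)$, $\{v^k\}\subset X^*$ with $x^k\to\bar x$, $r^k\to0$, $v^k\to\bar v$ and $v^k\in\mathcal M(x^k,r^k)$ for all $k$ belongs to $\mathcal M(\bar x,0)$. It is sw-AKKT regular if the same holds with $v^k\rightharpoonup^*\bar v$ in place of $v^k\to\bar v$, and w-AKKT regular if the same holds with $x^k\rightharpoonup\bar x$ in place of $x^k\to\bar x$ and $v^k\rightharpoonup^*\bar v$ in place of $v^k\to\bar v$. *)

(* Defs.v *)
From HB Require Import structures.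
From mathcomp Require Import all_boot all_order all_algebra.
From mathcomp Require Import all_classical all_reals all_analysis.

Set Implicit Arguments.
Unset Strict Implicit.
Unset Printing Implicit Defensive.

Import Order.TTheory GRing.Theory Num.Theory.
Import numFieldNormedType.Exports.

Local Open Scope classical_set_scope.
Local Open Scope ring_scope.

Section ContinuousLinearMaps.
Context {R : realType} {V W : normedModType R}.

Definition clin_pred : {pred V -> W} :=
  fun f => `[< linear f /\ continuous f >].

Lemma clin_predP (f : V -> W) :
  reflect (linear f /\ continuous f) (f \in clin_pred).
Proof. exact: asboolP. Qed.

Lemma clin_pred_submod : submod_closed clin_pred.
Proof.
split; first by apply/clin_predP; split=> [a x y|x];
  [rewrite /= scaler0 addr0 | exact: cvg_cst].
move=> a f g /clin_predP[lf cf] /clin_predP[lg cg]; apply/clin_predP; split.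
  move=> b x y; rewrite !fctE lf lg !scalerDr !scalerA mulrC.
  by rewrite -!addrA; congr +%R; rewrite addrCA.
by move=> x; apply: cvgD; [apply: cvgZr; exact: cf | exact: cg].
Qed.

HB.instance Definition _ :=
  GRing.isSubmodClosed.Build R (V -> W) clin_pred clin_pred_submod.

Record clin := CLin { clin_fun :> V -> W ; clin_funP : clin_fun \in clin_pred }.

HB.instance Definition _ := [isSub for clin_fun].
HB.instance Definition _ := [Choice of clin by <:].
HB.instance Definition _ := [SubChoice_isSubLmodule of clin by <:].

Lemma clin_linear (T : clin) : linear T.
Proof. by case/clin_predP: (clin_funP T). Qed.

Lemma clin_continuous (T : clin) : continuous T.
Proof. by case/clin_predP: (clin_funP T). Qed.

HB.instance Definition _ (T : clin) :=
  GRing.isLinear.Build R V W *:%R (clin_fun T) (clin_linear T).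

Definition opnorm (T : clin) : R :=
  sup [set `|T x| | x in [set x : V | `|x| <= 1]].

Lemma opnorm_has_sup (T : clin) :
  has_sup [set `|T x| | x in [set x : V | `|x| <= 1]].
Proof.
split; first by exists `|T 0|, 0 => //=; rewrite normr0.
have /linear_bounded_continuous/bounded_funP/(_ 1)[M TM] := @clin_continuous T.
by exists M => _ [x /= x1 <-]; exact: TM.
Qed.

Lemma opnorm_ub (T : clin) (x : V) : `|x| <= 1 -> `|T x| <= opnorm T.
Proof.
by move=> x1; apply: sup_upper_bound; [exact: opnorm_has_sup | exists x].
Qed.

Lemma opnorm_le (T : clin) (M : R) :
  (forall x, `|x| <= 1 -> `|T x| <= M) -> opnorm T <= M.
Proof.
move=> TM; apply: ge_sup; first by have [] := opnorm_has_sup T.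
by move=> _ [x /= x1 <-]; exact: TM.
Qed.

Lemma opnorm_ge0 (T : clin) : 0 <= opnorm T.
Proof. by rewrite (le_trans _ (@opnorm_ub T 0 _)) ?normr0. Qed.

Lemma opnormD (S T : clin) : opnorm (S + T) <= opnorm S + opnorm T.
Proof.
apply: opnorm_le => x x1.
by rewrite (le_trans (ler_normD _ _))// lerD// opnorm_ub.
Qed.

Lemma opnormZ_le (a : R) (T : clin) : opnorm (a *: T) <= `|a| * opnorm T.
Proof. by apply: opnorm_le => x x1; rewrite normrZ ler_wpM2l// opnorm_ub. Qed.

Lemma opnormZ (a : R) (T : clin) : opnorm (a *: T) = `|a| * opnorm T.
Proof.
apply/eqP; rewrite eq_le opnormZ_le/=.
have [->|a0] := eqVneq a 0; first by rewrite normr0 mul0r opnorm_ge0.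
rewrite -ler_pdivlMl ?normr_gt0// -normfV (le_trans _ (opnormZ_le _ _))//.
by rewrite scalerA mulVf// scale1r.
Qed.

Lemma opnorm0_eq0 (T : clin) : opnorm T = 0 -> T = 0.
Proof.
move=> T0; apply/val_inj/funext => x /=.
have [->|x0] := eqVneq x 0; first exact: linear0.
have nx0 : `|x|^-1 != 0 by rewrite invr_eq0 normr_eq0.
apply/eqP; rewrite -[_ == 0]orFb -(negbTE nx0) -scaler_eq0 -linearZ/=.
rewrite -normr_le0 -T0 opnorm_ub// normrZ normfV normr_id mulVf//.
by rewrite normr_eq0.
Qed.

HB.instance Definition _ :=
  Lmodule_isNormed.Build R clin opnormD opnormZ opnorm0_eq0.

End ContinuousLinearMaps.
Arguments clin {R} V W.
Arguments clin_pred {R} V W.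

Definition dual_space {R : realType} (V : normedModType R) : normedModType R :=
  clin V R^o.

Lemma adjoint_subproof {R : realType} {V W : normedModType R} (T : clin V W)
  (l : dual_space W) : ((l : W -> R^o) \o T) \in clin_pred V R^o.
Proof.
apply/clin_predP; split; first by move=> a x y /=; rewrite !linearP.
move=> x; apply: continuous_comp; exact: clin_continuous.
Qed.

Definition adjoint {R : realType} {V W : normedModType R} (T : clin V W)
  (l : dual_space W) : dual_space V := CLin (adjoint_subproof T l).

Definition reflexive_space {R : realType} (V : normedModType R) : Prop :=
  forall phi : dual_space (dual_space V),
    exists x : V, forall v : dual_space V, phi v = v x.

Definition weak_cvg {R : realType} {V : normedModType R} (u : V^nat) (l : V) :
    Prop :=
  forall v : dual_space V, v (u k) @[k --> \oo] --> v l.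

Definition weak_star_cvg {R : realType} {V : normedModType R}
    (v : (dual_space V)^nat) (l : dual_space V) : Prop :=
  forall x : V, v k x @[k --> \oo] --> l x.

(** ['d G x] as a continuous linear map; the default value [0] is only taken
    where ['d G x] is not continuous, hence [G] not differentiable. *)
Definition frechet {R : realType} {V W : normedModType R} (G : V -> W) (x : V) :
    clin V W :=
  insubd 0 ('d G x : V -> W).

Lemma frechetE {R : realType} {V W : normedModType R} (G : V -> W) (x : V) :
  differentiable G x -> frechet G x = 'd G x :> (V -> W).
Proof.
move=> dG; rewrite /frechet /insubd insubT//.
by apply/clin_predP; split; [exact: linearP | exact: diff_continuous].
Qed.

(** Continuity of the derivative is with respect to the operator norm. *)
Definition continuously_differentiable {R : realType} {V W : normedModType R}
    (G : V -> W) : Prop :=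
  (forall x, differentiable G x) /\ continuous (frechet G : V -> clin V W).

Definition weakly_seq_lsc {R : realType} {V : normedModType R} (f : V -> R^o) :
    Prop :=
  forall (u : V^nat) (x : V), weak_cvg u x ->
    ((f x)%:E <= limn_einf (fun k => (f (u k))%:E))%E.

Definition dist_to {R : realType} {V : normedModType R} (K : set V) (y : V) :
    R :=
  inf [set `|y - z| | z in K].

Definition normal_cone {R : realType} {V : normedModType R} (S : set V) (x : V) :
    set (dual_space V) :=
  [set v | S x /\ forall z, S z -> v (z - x) <= 0].

Section Problem.
Context {R : realType} {X Y : normedModType R}.
Implicit Types (f : X -> R^o) (G : X -> Y) (C : set X) (K : set Y) (x : X).

Definition feasible G C K : set X := [set x | C x /\ K (G x)].

Definition local_minimizer f G C K x : Prop :=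
  feasible G C K x /\ \forall z \near x, feasible G C K z -> f x <= f z.

Definition KKT_point f G C K x : Prop :=
  feasible G C K x /\
  exists l : dual_space Y,
    normal_cone C x (- (frechet f x : dual_space X) - adjoint (frechet G x) l)
    /\ normal_cone K (G x) l.

Definition Mset G C K x (r : R) : set (dual_space X) :=
  [set v | exists (l : dual_space Y) (mu : dual_space X),
     [/\ normal_cone C x mu,
         forall y, K y -> l (y - G x) <= r
       & v = adjoint (frechet G x) l + mu]].

Definition s_AKKT_regular G C K x : Prop :=
  feasible G C K x /\
  forall (vbar : dual_space X) (xs : X^nat) (r : R^nat) (v : (dual_space X)^nat),
    xs @ \oo --> x -> (forall k, 0 <= r k) -> r @ \oo --> (0 : R) ->
    v @ \oo --> vbar -> (forall k, Mset G C K (xs k) (r k) (v k)) ->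
    Mset G C K x 0 vbar.

Definition sw_AKKT_regular G C K x : Prop :=
  feasible G C K x /\
  forall (vbar : dual_space X) (xs : X^nat) (r : R^nat) (v : (dual_space X)^nat),
    xs @ \oo --> x -> (forall k, 0 <= r k) -> r @ \oo --> (0 : R) ->
    weak_star_cvg v vbar -> (forall k, Mset G C K (xs k) (r k) (v k)) ->
    Mset G C K x 0 vbar.

Definition w_AKKT_regular G C K x : Prop :=
  feasible G C K x /\
  forall (vbar : dual_space X) (xs : X^nat) (r : R^nat) (v : (dual_space X)^nat),
    weak_cvg xs x -> (forall k, 0 <= r k) -> r @ \oo --> (0 : R) ->
    weak_star_cvg v vbar -> (forall k, Mset G C K (xs k) (r k) (v k)) ->
    Mset G C K x 0 vbar.

End Problem.

(* Main.v *)
Require Import Defs.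
From HB Require Import structures.
From mathcomp Require Import all_boot all_order all_algebra.
From mathcomp Require Import all_classical all_reals all_analysis.
From mathcomp Require Import ring lra.

Set Implicit Arguments.
Unset Strict Implicit.
Unset Printing Implicit Defensive.

Import Order.TTheory GRing.Theory Num.Theory.
Import numFieldNormedType.Exports.

Local Open Scope classical_set_scope.
Local Open Scope ring_scope.

(** Every local minimizer admits approximate KKT points with [r = 0] and strong
    convergence, so already the weakest of the three notions, s-AKKT regularity,
    gives the theorem.  On [D], the intersection of [C] with a small closed ball
    around [xbar], apply Ekeland's principle from [xbar] to
    [phi_k z = f z + |z - xbar|^2 + k d_K (G z)].  Its value at the resulting
    point [x_k] is at most [f xbar], so [d_K (G x_k)] tends to [0]; a weak cluster
    point of [x_k] is thus feasible, and weak lower semicontinuity of [f] forces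
    [|x_k - xbar|] to be arbitrarily small for some [k].  At such a point
    linearization and Fenchel duality (Hahn-Banach) split the first-order
    condition into a small functional, a normal vector to [C], and [G'(x_k)^* l]
    with [l] a subgradient of [k d_K] at [G x_k]; the subgradient inequality
    yields [l (y - G x_k) <= - k d_K (G x_k) <= 0] for [y] in [K]. *)

(** * Hahn-Banach *)

(** Homogeneity is required only as an inequality, a form that passes directly to infima; equality
    follows in [sublinearZ] by rescaling with [c^-1]. *)
Definition sublinear {R : realType} {E : lmodType R} (q : E -> R) : Prop :=
  (forall x y, q (x + y) <= q x + q y) /\
  (forall c x, 0 < c -> q (c *: x) <= c * q x).

Section Sublinear.
Context {R : realType} {E : lmodType R}.
Implicit Types p q : E -> R.

Lemma sublinear0 q : sublinear q -> q 0 = 0.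
Proof.
move=> [qD qZ]; have := qD 0 0; have := qZ (2^-1) 0.
by rewrite scaler0 addr0 => /(_ _)/wrap[]; lra.
Qed.

Lemma sublinearZ q c x : sublinear q -> 0 <= c -> q (c *: x) = c * q x.
Proof.
move=> sq; rewrite le_eqVlt => /predU1P[<-|c0].
  by rewrite scale0r mul0r sublinear0.
case: (sq) => _ qZ; apply/eqP; rewrite eq_le qZ//=.
have := qZ c^-1 (c *: x); rewrite scalerA mulVf ?gt_eqF// scale1r invr_gt0.
by move=> /(_ c0); rewrite ler_pdivlMl.
Qed.

Lemma sublinear_opp q x : sublinear q -> - q (- x) <= q x.
Proof.
move=> sq; have [qD _] := sq.
by have := qD x (- x); rewrite subrr sublinear0//; lra.
Qed.

(** Zorn's lemma for the reversed pointwise order: a nonempty chain is bounded by its pointwise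
    infimum, which is finite because [- p (- x)] bounds every sublinear minorant of [p] from
    below. *)
Lemma minimal_sublinear p : sublinear p ->
  exists q, [/\ sublinear q, forall x, q x <= p x &
    forall q', sublinear q' -> (forall x, q' x <= q x) -> q' = q].
Proof.
move=> sp.
pose T := {q : E -> R | sublinear q /\ forall x, q x <= p x}.
pose le_ (q1 q2 : T) := `[< forall x, sval q2 x <= sval q1 x >].
have [||||q qmin] := @Zorn T le_.
- by move=> q; apply/asboolP.
- move=> q1 q2 q3 /asboolP le12 /asboolP le23; apply/asboolP => x.
  exact: le_trans (le23 x) (le12 x).
- move=> [q1 ?] [q2 ?] /asboolP le12 /asboolP le21; apply: eq_exist => /=.
  by apply/funext => x; apply/eqP; rewrite eq_le le12 le21.
- move=> A Atot; have [[q0 Aq0]|A0] := pselect (A !=set0); last first.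
    by exists (exist _ p (conj sp (fun x => lexx _))) => s As; case: A0; exists s.
  pose V x := [set sval q x | q in A].
  have V0 x : V x !=set0 by exists (sval q0 x), q0.
  have Vlb x : has_lbound (V x).
    exists (- p (- x)) => _ [[q [sq qp]] Aq <-] /=.
    by apply: le_trans (sublinear_opp x sq); rewrite lerN2.
  pose m x := inf (V x).
  have mlb (q : T) x : A q -> m x <= sval q x by move=> Aq; apply: ge_inf => //; exists q.
  have sm : sublinear m.
    split=> [x y|c x c0].
      rewrite -lerBlDr; apply: lb_le_inf => // _ [q1 Aq1 <-].
      rewrite lerBlDr -lerBlDl; apply: lb_le_inf => // _ [q2 Aq2 <-].
      rewrite lerBlDl.
      have [/asboolP le12|/asboolP le21] := Atot _ _ Aq1 Aq2.
        rewrite (le_trans (mlb _ _ Aq2))//; case: (svalP q2) => -[qD _] _.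
        by rewrite (le_trans (qD x y))// lerD2r.
      rewrite (le_trans (mlb _ _ Aq1))//; case: (svalP q1) => -[qD _] _.
      by rewrite (le_trans (qD x y))// lerD2l.
    rewrite -ler_pdivrMl//; apply: lb_le_inf => // _ [q Aq <-].
    rewrite ler_pdivrMl// (le_trans (mlb _ _ Aq))//.
    by case: (svalP q) => -[_ qZ] _; exact: qZ.
  have mp x : m x <= p x.
    by rewrite (le_trans (mlb _ _ Aq0))//; case: (svalP q0).
  exists (exist _ m (conj sm mp)) => s As; apply/asboolP => x; exact: mlb.
case: q qmin => q [sq qp] /= qmin; exists q; split=> // q' sq' q'q.
have q'p x : q' x <= p x by exact: le_trans (q'q x) (qp x).
have := qmin (exist _ q' (conj sq' q'p)); rewrite /le_/= => /(_ _)/wrap[].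
  exact/asboolP.
by move=> [].
Qed.

(** Minimality forces linearity: the infimum over [t >= 0] of [q (z + t *: y) - t * q y] is
    sublinear and at most [q], hence equals [q], and its bound at [t = 1] is superadditivity. *)
Lemma hahn_banach_sublinear p : sublinear p ->
  exists l : {linear E -> R^o}, forall x, l x <= p x.
Proof.
move=> /minimal_sublinear[q [sq qp qmin]]; have [qD _] := sq.
have qadd y x : q (x + y) = q x + q y.
  apply/eqP; rewrite eq_le qD/=.
  pose V x := [set q (x + t *: y) - t * q y | t in [set t : R | 0 <= t]].
  have V0 z : V z !=set0 by exists (q (z + 0 *: y) - 0 * q y), 0 => /=.
  have Vlb z : has_lbound (V z).
    exists (- q (- z)) => _ [t /= t0 <-].
    have := qD (- z) (z + t *: y); rewrite addrA addNr add0r.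
    by rewrite (sublinearZ _ sq t0); lra.
  pose m z := inf (V z).
  have mlb t z : 0 <= t -> m z <= q (z + t *: y) - t * q y.
    by move=> t0; apply: ge_inf => //; exists t.
  have sm : sublinear m.
    split=> [u v|c u c0].
      rewrite -lerBlDr; apply: lb_le_inf => // _ [t /= t0 <-].
      rewrite lerBlDr -lerBlDl; apply: lb_le_inf => // _ [s /= s0 <-].
      rewrite lerBlDl (le_trans (mlb (t + s) _ _)) ?addr_ge0//.
      rewrite scalerDl addrACA; have := qD (u + t *: y) (v + s *: y); lra.
    rewrite -ler_pdivrMl//; apply: lb_le_inf => // _ [t /= t0 <-].
    rewrite ler_pdivrMl// (le_trans (mlb (c * t) _ _)) ?mulr_ge0 ?(ltW c0)//.
    by rewrite -scalerA -scalerDr (sublinearZ _ sq (ltW c0)) mulrBr mulrA.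
  suff mq : m = q by have := mlb 1 x ler01; rewrite scale1r mq; lra.
  apply: qmin => // z; have := mlb 0 z (lexx _).
  by rewrite scale0r addr0 mul0r subr0.
have qN x : q (- x) = - q x.
  by have := qadd x (- x); rewrite addNr sublinear0//; lra.
have lin_q : linear (q : E -> R^o).
  move=> a x y; rewrite qadd; congr (_ + _).
  have [a0|a0] := leP 0 a; first by rewrite sublinearZ.
  by rewrite -[in LHS](opprK a) scaleNr qN sublinearZ ?oppr_ge0 ?ltW// mulNr opprK.
pose lq := GRing.isLinear.Build R E R^o *:%R q lin_q.
pose l : {linear E -> R^o} := HB.pack q lq.
by exists l.
Qed.

End Sublinear.

(* The geometric form, for the epigraph [S] of a convex function that need not
   be given by a formula: [S e r] reads "the value at [e] is at most [r]". *)
Lemma hahn_banach_convex (R : realType) (E : lmodType R) (S : E -> R -> Prop) :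
  (forall t e1 r1 e2 r2, 0 <= t -> t <= 1 -> S e1 r1 -> S e2 r2 ->
     S (t *: e1 + (1 - t) *: e2) (t * r1 + (1 - t) * r2)) ->
  (forall e, exists r, S e r) -> (forall r, S 0 r -> 0 <= r) ->
  exists l : {linear E -> R^o}, forall e r, S e r -> l e <= r.
Proof.
move=> convS totS S0.
(* The weights [t2 / (t1 + t2)] and [t1 / (t1 + t2)] give [e1] and [e2] the same coefficient. *)
have combS t1 t2 e1 r1 e2 r2 : 0 < t1 -> 0 < t2 ->
    S (t1 *: e1) r1 -> S (t2 *: e2) r2 ->
    S ((t1 * t2 / (t1 + t2)) *: (e1 + e2)) ((t2 * r1 + t1 * r2) / (t1 + t2)).
  move=> t10 t20 S1 S2; have t12 : 0 < t1 + t2 by rewrite addr_gt0.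
  have n12 : t1 + t2 != 0 by rewrite gt_eqF.
  have w0 : 0 <= t2 / (t1 + t2) by rewrite divr_ge0 ?ltW.
  have w1 : t2 / (t1 + t2) <= 1 by rewrite ler_pdivrMr// mul1r lerDr ltW.
  have := convS _ _ _ _ _ w0 w1 S1 S2.
  have -> : 1 - t2 / (t1 + t2) = t1 / (t1 + t2) by field.
  rewrite !scalerA mulrAC [t2 * t1]mulrC [t1 / _ * _]mulrAC -scalerDr.
  by congr (S _ _); field.
(* The infimum of [V e] is the positively homogeneous hull of the convex function; it is finite
   because [V (- e)] is nonempty and [S] is nonnegative at [0]. *)
pose V e := [set r | exists t r', [/\ 0 < t, S (t *: e) r' & r = r' / t]].
have V0 e : V e !=set0.
  by have [r Ser] := totS e; exists r, 1, r; rewrite scale1r divr1.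
have Vopp e r r' : V e r -> V (- e) r' -> 0 <= r + r'.
  move=> [t [s [t0 Ss ->]]] [t' [s' [t'0 Ss' ->]]].
  have := combS _ _ _ _ _ _ t0 t'0 Ss Ss'; rewrite subrr scaler0 => /S0.
  rewrite pmulr_lge0 ?invr_gt0 ?addr_gt0// => h.
  have -> : s / t + s' / t' = (t' * s + t * s') / (t * t').
    by field; rewrite !gt_eqF.
  by rewrite divr_ge0// ltW// mulr_gt0.
have Vlb e : has_lbound (V e).
  have [r' Vr'] := V0 (- e).
  by exists (- r') => r Vr; rewrite -subr_ge0 opprK; exact: Vopp Vr Vr'.
pose p e := inf (V e).
have plb e r : V e r -> p e <= r by move=> ?; exact: ge_inf.
have sp : sublinear p.
  split=> [x y|c x c0].
    rewrite -lerBlDr; apply: lb_le_inf => // _ [t [r [t0 Sr ->]]].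
    rewrite lerBlDr -lerBlDl; apply: lb_le_inf => // _ [t' [r' [t'0 Sr' ->]]].
    rewrite lerBlDl; apply: plb.
    exists (t * t' / (t + t')), ((t' * r + t * r') / (t + t')); split.
    - by rewrite divr_gt0 ?mulr_gt0 ?addr_gt0.
    - exact: combS.
    - by field; rewrite !gt_eqF// addr_gt0.
  rewrite -ler_pdivrMl//; apply: lb_le_inf => // _ [t [r [t0 Sr ->]]].
  rewrite ler_pdivrMl//; apply: plb; exists (t / c), r; split.
  - exact: divr_gt0.
  - by rewrite scalerA divfK// gt_eqF.
  - by field; rewrite !gt_eqF.
have [l lp] := hahn_banach_sublinear sp.
exists l => e r Ser; rewrite (le_trans (lp e))//; apply: plb.
by exists 1, r; rewrite scale1r divr1.
Qed.

(** * Bounded linear functionals: norming and separation *)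

Section BoundedFunctionals.
Context {R : realType}.

Lemma scale_convD (V : lmodType R) (t s : R) (a b c d : V) :
  t *: (a + b) + s *: (c + d) = (t *: a + s *: c) + (t *: b + s *: d).
Proof. by rewrite !scalerDr addrACA. Qed.

Lemma scale_convv (V : lmodType R) (t : R) (a : V) :
  t *: a + (1 - t) *: a = a.
Proof. by rewrite -scalerDl addrC subrK scale1r. Qed.

Lemma scale_conv_sub (V : lmodType R) (t : R) (a b : V) :
  t *: a + (1 - t) *: b = b + t *: (a - b).
Proof. by rewrite scalerBl scale1r scalerBr addrCA. Qed.

Lemma clin_norm_le {V W : normedModType R} (T : clin V W) x :
  `|T x| <= opnorm T * `|x|.
Proof.
have [->|x0] := eqVneq x 0; first by rewrite linear0 !normr0 mulr0.
have nx : 0 < `|x| by rewrite normr_gt0.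
have := @opnorm_ub _ _ _ T (`|x|^-1 *: x).
rewrite linearZ/= !normrZ normfV normr_id mulVf ?gt_eqF// => /(_ (lexx _)).
by rewrite ler_pdivrMl// mulrC.
Qed.

(* The codomain of [linearB] on a functional is [R^o], which blocks rewriting in [R]. *)
Lemma dualB {V : normedModType R} (v : dual_space V) x y :
  v (x - y) = (v x : R) - v y.
Proof. exact: linearB. Qed.

Lemma dualN {V : normedModType R} (v : dual_space V) x : v (- x) = - (v x : R).
Proof. exact: linearN. Qed.

Lemma clin_of_linear_le {V : normedModType R} (l : {linear V -> R^o}) (M : R) :
  0 <= M -> (forall x, l x <= M * `|x|) ->
  exists2 v : dual_space V, (forall x, v x = l x) & `|v| <= M.
Proof.
move=> M0 lM; have lM' x : `|l x : R| <= M * `|x|.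
  by rewrite ler_norml lM andbT lerNl -linearN -normrN lM.
have cl : continuous l.
  apply/linear_bounded_continuous/bounded_funP => r; exists (M * r) => x xr.
  by rewrite (le_trans (lM' x))// ler_wpM2l.
have lP : (l : V -> R^o) \in clin_pred V R^o.
  by apply/clin_predP; split => //; exact: linearP.
exists (CLin lP) => //; apply: opnorm_le => x x1.
by rewrite (le_trans (lM' x))// ler_piMr.
Qed.

(** Hahn-Banach is applied to the infimum over [t] of [|e + t *: x| - t * |x|]: the choice [t = 0]
    bounds [l] by the norm, and [e = - x], [t = 1] gives [l (- x) <= - |x|]. *)
Lemma norming_functional {V : normedModType R} (x : V) :
  exists2 v : dual_space V, forall y, v y <= `|y| & v x = `|x|.
Proof.
pose S (e : V) (r : R) := exists t, `|e + t *: x| - t * `|x| <= r.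
have [|||l lS] := @hahn_banach_convex R V S.
- move=> t e1 r1 e2 r2 t0 t1 [s1 le1] [s2 le2].
  exists (t * s1 + (1 - t) * s2).
  have -> : t *: e1 + (1 - t) *: e2 + (t * s1 + (1 - t) * s2) *: x =
            t *: (e1 + s1 *: x) + (1 - t) *: (e2 + s2 *: x).
    by rewrite !scalerDr !scalerA addrACA -scalerDl.
  rewrite lerBlDr (le_trans (ler_normD _ _))// !normrZ !ger0_norm ?subr_ge0//.
  by rewrite -subr_ge0 in t1; nra.
- by move=> e; exists (`|e + 0 *: x| - 0 * `|x|), 0.
- move=> r [t]; apply: le_trans.
  by rewrite add0r normrZ -mulrBl mulr_ge0// subr_ge0 ler_norm.
have lx y : l y <= 1 * `|y|.
  by apply: lS; exists 0; rewrite scale0r addr0 mul0r subr0 mul1r.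
have [v vl _] := clin_of_linear_le ler01 lx.
exists v => [y|]; first by rewrite vl (le_trans (lx y)) ?mul1r.
apply/eqP; rewrite vl eq_le; apply/andP; split.
  by rewrite (le_trans (lx x)) ?mul1r.
rewrite -lerN2 -linearN; apply: lS; exists 1.
by rewrite scale1r addNr normr0 mul1r sub0r.
Qed.

(** Hahn-Banach is applied to the infimum over [y] in [D] of [|y - x + e| - d], nonnegative at
    [e = 0]; the choice [e = - (y - x)] then gives the separation. *)
Lemma separating_functional {V : normedModType R} (D : set V) (x : V) (d : R) :
  (forall t y z, 0 <= t -> t <= 1 -> D y -> D z -> D (t *: y + (1 - t) *: z)) ->
  D !=set0 -> (forall y, D y -> d <= `|y - x|) ->
  exists v : dual_space V, forall y, D y -> d <= v (y - x).
Proof.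
move=> cD [y0 Dy0] dD.
pose S (e : V) (r : R) := exists2 y, D y & `|y - x + e| - d <= r.
have [|||l lS] := @hahn_banach_convex R V S.
- move=> t e1 r1 e2 r2 t0 t1 [y1 Dy1 le1] [y2 Dy2 le2].
  exists (t *: y1 + (1 - t) *: y2); first exact: cD.
  have -> : t *: y1 + (1 - t) *: y2 - x + (t *: e1 + (1 - t) *: e2) =
            t *: (y1 - x + e1) + (1 - t) *: (y2 - x + e2).
    by rewrite !scale_convD scale_convv.
  rewrite lerBlDr (le_trans (ler_normD _ _))// !normrZ !ger0_norm ?subr_ge0//.
  by rewrite -subr_ge0 in t1; nra.
- by move=> e; exists (`|y0 - x + e| - d), y0.
- by move=> r [y Dy]; apply: le_trans; rewrite addr0 subr_ge0 dD.
(* [S] bounds [l] by the norm plus the constant [|y0 - x| - d]. A vector violating the bound without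
   the constant would, scaled by [t], violate the bound with it. *)
have lM y : l y <= 1 * `|y|.
  rewrite mul1r leNgt; apply/negP => yl.
  pose c := `|y0 - x| - d + 1.
  have c0 : 0 < c by rewrite /c ltr_wpDl// subr_ge0 dD.
  pose t := c / (l y - `|y|).
  have t0 : 0 < t by rewrite divr_gt0// subr_gt0.
  have : l (t *: y) <= `|y0 - x| + t * `|y| - d.
    apply: lS; exists y0 => //; rewrite lerD2r (le_trans (ler_normD _ _))//.
    by rewrite normrZ gtr0_norm.
  rewrite linearZ/= -[_ *: _]/(t * l y) => h.
  have : t * (l y - `|y|) = c by rewrite /t divfK// gt_eqF// subr_gt0.
  by rewrite /c in h *; nra.
have [v vl _] := clin_of_linear_le ler01 lM.
exists v => y Dy; rewrite vl -lerN2 -linearN; apply: lS; exists y => //.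
by rewrite subrr normr0 sub0r.
Qed.

End BoundedFunctionals.

(** * Weak limits in reflexive spaces *)

Section WeakLimits.
Context {R : realType}.

Lemma ultra_bounded_cvg (F : set_system nat) (a : R^nat) (M : R) :
  UltraFilter F -> (forall n, `|a n| <= M) -> exists l : R, a @ F --> l.
Proof.
move=> FU aM; have FP := @ultra_proper _ _ FU.
have Fseg : F (a @^-1` `[- M, M]%classic).
  by apply: filterE => n /=; rewrite in_itv/= -ler_norml.
have [l [_ ll]] := @segment_compact R (- M) M (a @ F) _ Fseg.
exists l => B Bl; have [//|FnB] := in_ultra_setVsetC (a @^-1` B) FU.
by have [z []] := ll (~` B) B FnB Bl.
Qed.

Lemma closure_normP (V : normedModType R) (A : set V) x :
  closure A x <-> forall e, 0 < e -> exists2 y, A y & `|x - y| < e.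
Proof.
split=> [+ e e0|xA B /nbhs_ballP[e e0 xB]].
  move=> /(_ _ (nbhsx_ballx x _ e0))[y [Ay]].
  by rewrite -ball_normE => xy; exists y.
by have [y Ay xy] := xA _ e0; exists y; split => //; apply: xB; rewrite -ball_normE.
Qed.

(** The filter on the indices is arbitrary, so that limits along ultrafilters are available before
    any reindexing has been extracted. *)
Definition weakly_tends {V : normedModType R} (u : V^nat) (F : set_system nat)
    (x : V) :=
  forall v : dual_space V, (v (u n) : R) @[n --> F] --> (v x : R).

(** The limits of [v (u n)] along [F] form a linear functional of [v] bounded by [M]; reflexivity
    represents it by a point. *)
Lemma reflexive_ultra_weak_limit {V : normedModType R} (u : V^nat) (M : R)
    (F : set_system nat) :
  reflexive_space V -> (forall n, `|u n| <= M) -> UltraFilter F ->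
  exists x, weakly_tends u F x.
Proof.
move=> reflV uM FU; have FP := @ultra_proper _ _ FU.
have M0 : 0 <= M := le_trans (normr_ge0 _) (uM 0%N).
have vuM (v : dual_space V) n : `|v (u n) : R| <= M * `|v|.
  by rewrite (le_trans (clin_norm_le v _))// mulrC ler_wpM2r// opnorm_ge0.
have /choice[phi phiP] (v : dual_space V) :
    exists l : R, (v (u n) : R) @[n --> F] --> l.
  exact: (ultra_bounded_cvg FU (vuM v)).
have phi_lin : linear (phi : dual_space V -> R^o).
  move=> a v w; apply: (cvg_unique _ (phiP _)) => //.
  by apply: cvgD; [apply: cvgM; [exact: cvg_cst|exact: phiP]|exact: phiP].
pose lphi := GRing.isLinear.Build R (dual_space V) R^o *:%R phi phi_lin.
pose l : {linear dual_space V -> R^o} := HB.pack phi lphi.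
have lM v : l v <= M * `|v|.
  apply: (@closed_cvg _ _ F _ _ (fun y : R => y <= M * `|v|)) (phiP v).
  - exact: closed_le.
  - by apply: filterE => n; rewrite (le_trans (ler_norm _)).
have [psi psil _] := clin_of_linear_le M0 lM.
have [x xP] := reflV psi.
by exists x => v; rewrite -xP psil; exact: phiP.
Qed.

(** Mazur's argument: a functional separating [x] from [D] with gap [d] keeps [v (u n)] at distance
    at least [d] from [v x]. *)
Lemma closed_convex_weakly_tends {V : normedModType R} (D : set V) (u : V^nat)
    (F : set_system nat) (x : V) :
  (forall t y z, 0 <= t -> t <= 1 -> D y -> D z -> D (t *: y + (1 - t) *: z)) ->
  closed D -> ProperFilter F -> (forall n, D (u n)) -> weakly_tends u F x -> D x.
Proof.
move=> cD clD FP Du ux; apply: contrapT => nDx.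
have : nbhs x (~` D) by apply: open_nbhs_nbhs; split => //; exact: closed_openC.
move=> /nbhs_ballP[d d0 xd].
have [||v vd] := @separating_functional R V D x d cD.
- by exists (u 0%N).
- move=> y Dy; rewrite leNgt distrC; apply/negP => yx.
  by apply: (xd y) => //; rewrite -ball_normE.
have /cvgrPdist_lt/(_ _ d0) := ux v.
move=> /filter_ex[n]; rewrite distrC -linearB => h.
by have := vd _ (Du n); rewrite leNgt (le_lt_trans (ler_norm _) h).
Qed.

End WeakLimits.

(** * Weak sequential compactness in reflexive spaces *)

Section WeakSequentialCompactness.
Context {R : realType} {V : normedModType R}.

(** Polynomials over [rat] encode the coefficients because they form a countable type, on which the
    diagonal choice of indices relies. *)
Definition rat_comb (u : V^nat) (p : {poly rat}) : V :=
  \sum_(i < size p) (ratr p`_i : R) *: u i.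

Lemma rat_combE (u : V^nat) (p : {poly rat}) n : (size p <= n)%N ->
  rat_comb u p = \sum_(i < n) (ratr p`_i : R) *: u i.
Proof.
move=> pn; rewrite /rat_comb (big_ord_widen n (fun i => (ratr p`_i : R) *: u i) pn).
rewrite big_mkcond/=; apply: eq_bigr => i _; case: ltnP => // ip.
by rewrite nth_default// raddf0 scale0r.
Qed.

Lemma rat_combD (u : V^nat) (p q : {poly rat}) :
  rat_comb u (p + q) = rat_comb u p + rat_comb u q.
Proof.
have n1 := leq_maxl (size p) (size q); have n2 := leq_maxr (size p) (size q).
rewrite (rat_combE u n1) (rat_combE u n2) (rat_combE u (size_polyD p q)).
rewrite -big_split/=; apply: eq_bigr => i _.
by rewrite coefD rmorphD/= scalerDl.
Qed.

Lemma rat_combZ (u : V^nat) (c : rat) (p : {poly rat}) :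
  rat_comb u (c *: p) = (ratr c : R) *: rat_comb u p.
Proof.
rewrite (rat_combE u (size_scale_leq c p)) /rat_comb scaler_sumr.
by apply: eq_bigr => i _; rewrite coefZ rmorphM/= scalerA.
Qed.

Lemma rat_combX (u : V^nat) i : rat_comb u 'X^i = u i.
Proof.
rewrite (@rat_combE _ _ i.+1) ?size_polyXn// big_ord_recr/= coefXn eqxx rmorph1.
rewrite scale1r big1 ?add0r// => j _.
by rewrite coefXn ltn_eqF// rmorph0 scale0r.
Qed.

(** A real [t] is replaced by a nearby rational [c]; that [c] may exceed 1 is harmless, since all
    rational combinations are allowed. *)
Lemma closure_rat_comb_convex (u : V^nat) t y z : 0 <= t -> t <= 1 ->
  closure (range (rat_comb u)) y -> closure (range (rat_comb u)) z ->
  closure (range (rat_comb u)) (t *: y + (1 - t) *: z).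
Proof.
move=> t0 t1 /closure_normP Cy /closure_normP Cz; apply/closure_normP => e e0.
have e20 : 0 < e / 2 by rewrite divr_gt0.
have [_ [p _ <-] py] := Cy _ e20; have [_ [q _ <-] qz] := Cz _ e20.
(* The left side is the cost of moving [t] by [d]; the right side is the room left by the two
   approximation errors. *)
have [d d0 de] : exists2 d, 0 < d &
    d * `|rat_comb u p - rat_comb u q| < e / 2 -
      (t * `|y - rat_comb u p| + (1 - t) * `|z - rat_comb u q|).
  set D := `|_ - rat_comb u q|; set s := _ - (_ + _).
  have s0 : 0 < s.
    rewrite subr_gt0; rewrite -subr_ge0 in t1.
    set a := `|y - _| in py *; set b := `|z - _| in qz *.
    have [->|tn0] := eqVneq t 0; first by rewrite mul0r add0r subr0 mul1r.
    have : 0 < t by rewrite lt_neqAle eq_sym tn0.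
    by nra.
  exists (s / 2 / (D + 1)); first by rewrite !divr_gt0// ltr_wpDl// normr_ge0.
  have D1 : 0 < D + 1 by rewrite ltr_wpDl// normr_ge0.
  rewrite mulrAC ltr_pdivrMr//.
  have : 0 <= D := normr_ge0 _.
  by nra.
have [c] : exists c : rat, ratr c \in `]t, (t + d)[.
  by apply: rat_in_itvoo; rewrite ltrDl.
rewrite in_itv/= => /andP[tc ctd].
exists (rat_comb u (c *: p + (1 - c) *: q)); first by exists (c *: p + (1 - c) *: q).
rewrite rat_combD !rat_combZ rmorphB rmorph1/=.
have -> : t *: y + (1 - t) *: z -
    (ratr c *: rat_comb u p + (1 - ratr c) *: rat_comb u q) =
    t *: (y - rat_comb u p) + (1 - t) *: (z - rat_comb u q) -
    (ratr c - t) *: (rat_comb u p - rat_comb u q).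
  rewrite scale_convD !scalerN -opprD -[RHS]addrA -opprD; congr (_ - _).
  by rewrite !scale_conv_sub -addrA -scalerDl [t + _]addrC subrK.
rewrite (le_lt_trans (ler_normB _ _))// (le_lt_trans (lerD (ler_normD _ _) (lexx _)))//.
rewrite !normrZ !ger0_norm ?subr_ge0 ?(ltW tc)//.
have : (ratr c - t) * `|rat_comb u p - rat_comb u q| <=
       d * `|rat_comb u p - rat_comb u q|.
  by rewrite ler_wpM2r// lerBlDl ltW.
lra.
Qed.

(* Eberlein-Smulian for a reflexive space: countably many functionals norming a
   dense subset of the span of [u] determine its weak cluster points. *)
Lemma reflexive_weak_seq_compact (u : V^nat) (M : R) :
  reflexive_space V -> (forall n, `|u n| <= M) ->
  exists x (phi : nat -> nat),
    (forall k, (k <= phi k)%N) /\ weak_cvg (u \o phi) x.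
Proof.
move=> reflV uM.
(* [Z] is closed and convex, so it contains every weak limit of reindexings of [u]; functionals
   separating points of [Z] therefore suffice. *)
pose Z := closure (range (rat_comb u)).
have Zu n : Z (u n).
  by apply: subset_closure; exists 'X^n => //; rewrite rat_combX.
have Zlim (F : set_system nat) (psi : nat -> nat) x :
    ProperFilter F -> weakly_tends (u \o psi) F x -> Z x.
  move=> FP; apply: closed_convex_weakly_tends.
  - exact: closure_rat_comb_convex.
  - exact: closed_closure.
  - by move=> n; exact: Zu.
have /choice[w wP] (p : {poly rat}) : exists v : dual_space V,
    (forall y, v y <= `|y|) /\ v (rat_comb u p) = `|rat_comb u p|.
  by have [v] := norming_functional (rat_comb u p); exists v.
(* For [x] and [y] distinct, the functional norming the difference of rational approximations within
   [|x - y| / 4] cannot vanish on [x - y]. *)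
have wsep x y : Z x -> Z y -> (forall p, w p x = w p y) -> x = y.
  move=> /closure_normP Zx /closure_normP Zy wxy.
  apply/eqP; rewrite -subr_eq0 -normr_le0 leNgt; apply/negP => xy0.
  have e0 : 0 < `|x - y| / 4 by rewrite divr_gt0.
  have [_ [p _ <-] px] := Zx _ e0; have [_ [q _ <-] qy] := Zy _ e0.
  set P := rat_comb u p in px; set Q := rat_comb u q in qy.
  have PQ : rat_comb u (p + (-1) *: q) = P - Q.
    by rewrite rat_combD rat_combZ rmorphN1 scaleN1r.
  have [w1 w2] := wP (p + (-1) *: q); rewrite PQ in w2.
  set v := w _ in w1 w2.
  have v0 : v (x - y) = 0 by rewrite dualB [v x]wxy subrr.
  have E : (x - P) - (y - Q) = (x - y) - (P - Q).
    by rewrite !opprB [Q - y]addrC addrACA [- P + Q]addrC.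
  have n1 : `|P - Q| <= `|x - P| + `|y - Q|.
    rewrite -w2.
    have -> : P - Q = (x - y) - ((x - P) - (y - Q)) by rewrite E subKr.
    rewrite dualB v0 sub0r -dualN (le_trans (w1 _))// normrN.
    exact: ler_normB.
  have n2 : `|x - y| <= `|P - Q| + (`|x - P| + `|y - Q|).
    have -> : x - y = (P - Q) + ((x - P) - (y - Q)) by rewrite E [RHS]addrC subrK.
    by rewrite (le_trans (ler_normD _ _))// lerD2l ler_normB.
  by lra.
have [U [UU oU]] := ultraFilterLemma (eventually_filter : ProperFilter \oo).
have UP := @ultra_proper _ _ UU.
have [x ux] := reflexive_ultra_weak_limit reflV uM UU.
have Zx : Z x by apply: (Zlim U id).
(* Enumeration of the family [w]; numbers coding no polynomial get the zero functional. *)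
pose wn n := if @unpickle {poly rat} n is Some p then w p else 0.
(* Diagonal choice: [phi k] makes the first [k] functionals accurate to [1 / (k + 1)]. *)
have /choice[phi phiP] k : exists n, (k <= n)%N /\
    forall i, (i < k)%N -> `|(wn i x : R) - wn i (u n)| < k.+1%:R^-1.
  apply: (@filter_ex _ U); apply: filterI.
    by apply: oU; exists k.
  elim: {1}k => [|j IH]; first by apply: filterE.
  have /cvgrPdist_lt/(_ k.+1%:R^-1) := ux (wn j).
  rewrite invr_gt0 ltr0n => /(_ isT) h; near=> n.
  move=> i; rewrite ltnS leq_eqVlt => /predU1P[->|ij]; first by near: n.
  by move: i ij; near: n.
exists x, phi; split=> [k|v]; first by case: (phiP k).
have wphi p : (w p (u (phi k)) : R) @[k --> \oo] --> (w p x : R).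
  apply/cvgrPdist_lt => e e0.
  near=> k.
  have wnp : wn (pickle p) = w p by rewrite /wn pickleK.
  have [_ /(_ (pickle p))] := phiP k; rewrite wnp => h.
  apply: (lt_trans (h _)); first by near: k; exists (pickle p).+1.
  near: k; exact: near_infty_natSinv_lt (PosNum e0).
(* If convergence fails for [v], the bad indices carry an ultrafilter [G] finer than [\oo]. The weak
   limit [y] along [G] agrees with [x] on every [w p], hence equals [x], which the bad indices
   contradict. *)
apply/cvgrPdist_lt => e e0; apply: contrapT => nB.
pose B := [set k | e <= `|(v x : R) - v (u (phi k))|].
have BP : ProperFilter (within B \oo).
  split; last exact: within_filter.
  rewrite /within/= => h; apply: nB; near=> k; rewrite ltNge; apply/negP => Bk.
  have : B k -> False by near: k.
  exact.
have [G [GU BG]] := ultraFilterLemma BP.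
have GP := @ultra_proper _ _ GU.
have oG : G --> \oo by move=> A oA; apply: BG; apply: filterS oA.
have uMphi n : `|(u \o phi) n| <= M by exact: uM.
have [y uy] := reflexive_ultra_weak_limit reflV uMphi GU.
have Zy : Z y by apply: (Zlim G phi).
have xy : x = y.
  apply: wsep => // p; apply: (cvg_unique _ _ (uy (w p))) => //.
  apply: cvg_trans (wphi p); exact: cvg_app.
have /cvgrPdist_lt/(_ _ e0) := uy v; rewrite -xy => h.
have GB : G B by apply: BG; exact: withinT.
have [k [/= Bk hk]] := filter_ex (filterI GB h).
by move: Bk; rewrite /B/= leNgt hk.
Unshelve. all: by end_near. Qed.

End WeakSequentialCompactness.

(** * Ekeland's variational principle *)

(** Each step moves to a point of [S x] that at least halves the gap between [phi x] and the infimum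
    of [phi] over [S x]. The iterates are Cauchy because [e * |u k - u n|] is at most the decrease
    of [phi]. *)
Lemma ekeland (R : realType) (X : completeNormedModType R) (D : set X)
    (phi : X -> R) (x0 : X) (e m : R) :
  closed D -> D x0 -> continuous phi -> (forall x, D x -> m <= phi x) ->
  0 < e -> exists x, [/\ D x, phi x + e * `|x - x0| <= phi x0 &
    forall y, D y -> phi x <= phi y + e * `|y - x|].
Proof.
move=> clD Dx0 cphi mphi e0.
pose S x := [set y | D y /\ phi y + e * `|y - x| <= phi x].
(* The last inequality is the halving of the gap, stated without the infimum. *)
have /choice[next nextP] x : exists y, D x -> S x y /\
    forall z, S x z -> 2 * phi y - phi x <= phi z.
  have [Dx|nDx] := pselect (D x); last by exists x.
  have Sx : S x x by split => //; rewrite subrr normr0 mulr0 addr0.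
  have lbS : has_lbound (phi @` S x) by exists m => _ [z [Dz _] <-]; exact: mphi.
  have S0 : phi @` S x !=set0 by exists (phi x), x.
  pose i := inf (phi @` S x).
  have iS z : S x z -> i <= phi z by move=> Sz; apply: ge_inf => //; exists z.
  have := iS _ Sx; rewrite le_eqVlt => /predU1P[ix|ix].
    by exists x => _; split => // z /iS; rewrite ix; lra.
  have [|_ [y Sy <-] yi] := @inf_lt _ (phi @` S x) ((i + phi x) / 2) S0.
    by rewrite -/i; lra.
  by exists y => _; split => // z /iS; lra.
pose u n := iter n next x0.
have Du n : D (u n) by elim: n => // n Dn; case: (nextP _ Dn) => -[].
have Su n : S (u n) (u n.+1) by case: (nextP _ (Du n)).
have uD n k : phi (u (n + k)%N) + e * `|u (n + k)%N - u n| <= phi (u n).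
  elim: k => [|k IH]; first by rewrite addn0 subrr normr0 mulr0 addr0.
  have [_] := Su (n + k)%N; rewrite addnS => Sk.
  have : e * `|u (n + k).+1 - u n| <=
      e * `|u (n + k).+1 - u (n + k)%N| + e * `|u (n + k)%N - u n|.
    by rewrite -mulrDr ler_wpM2l ?(ltW e0)// ler_distD.
  by lra.
have uph n k : (n <= k)%N -> phi (u k) + e * `|u k - u n| <= phi (u n).
  by move=> /subnKC <-; exact: uD.
have ndec : nonincreasing_seq (phi \o u).
  move=> n k /uph /=; apply: le_trans.
  by rewrite lerDl mulr_ge0// ltW.
have cphiu : cvgn (phi \o u).
  by apply: nonincreasing_is_cvgn => //; exists m => _ [n _ <-]; exact: mphi.
pose L := limn (phi \o u).
have Lphi n : L <= phi (u n) by exact: nonincreasing_cvgn_ge.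
have cu : cvgn u.
  apply/cauchy_cvgP/cauchy_exP => d d0.
  have /cvgrPdist_lt/(_ (e * d)) : (phi \o u) n @[n --> \oo] --> L by [].
  rewrite mulr_gt0// => /(_ isT)[N _ NL]; exists (u N), N => // k /= Nk.
  rewrite -ball_normE/= distrC -(ltr_pM2l e0).
  have := NL N (leqnn N); rewrite /= ltr_norml => /andP[+ _].
  by have := uph _ _ Nk; have := Lphi k; lra.
have [x ux] : exists x : X, u n @[n --> \oo] --> x by move/cvg_ex: cu => [x ux]; exists x.
have Dx : D x.
  by apply: (@closed_cvg _ _ \oo _ u D) ux => //; exact: nearW.
have Sux n : phi x + e * `|x - u n| <= phi (u n).
  pose psi z := phi z + e * `|z - u n|.
  have cpsi : psi (u k) @[k --> \oo] --> psi x.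
    apply: cvgD; first by apply: continuous_cvg => //; exact: cphi.
    apply: cvgM; first exact: cvg_cst.
    by apply: cvg_norm; apply: cvgB => //; exact: cvg_cst.
  apply: (@closed_cvg _ _ \oo _ (psi \o u) (fun y : R => y <= phi (u n))) cpsi.
    exact: closed_le.
  by exists n => // k /= nk; exact: uph.
exists x; split => // [|y Dy]; first exact: (Sux 0%N).
rewrite leNgt; apply/negP => yx.
(* A [y] violating the conclusion lies in every [S (u n)], so halving gives
   [2 * phi (u n.+1) - phi (u n) <= phi y], whose left side tends to [L >= phi x]. *)
have Sy n : S (u n) y.
  split => //; have := Sux n.
  have : e * `|y - u n| <= e * `|y - x| + e * `|x - u n|.
    by rewrite -mulrDr ler_wpM2l ?(ltW e0)// ler_distD.
  by lra.
have xL : phi x <= L.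
  apply: limr_ge => //; apply: nearW => n /=; rewrite (le_trans _ (Sux n))//.
  by rewrite lerDl mulr_ge0// ltW.
have d0 : 0 < phi x - phi y.
  by rewrite subr_gt0 (le_lt_trans _ yx)// lerDl mulr_ge0// ltW.
have /cvgrPdist_lt/(_ _ d0)[N _ NL] : (phi \o u) n @[n --> \oo] --> L by [].
have := NL N (leqnn N); rewrite /= ltr_norml => /andP[+ _].
have [_ /(_ _ (Sy N))] := nextP _ (Du N).
by have := Lphi N.+1; rewrite /=; lra.
Qed.

(** * Distance functions and multipliers *)

Lemma convex_setP (R : realType) (V : lmodType R) (D : set V) :
  convex_set D -> forall t y z, 0 <= t -> t <= 1 -> D y -> D z ->
  D (t *: y + (1 - t) *: z).
Proof.
move=> cD t y z t0 t1 Dy Dz.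
by have := cD y z (Itv01 t0 t1) (mem_set Dy) (mem_set Dz); rewrite inE.
Qed.

Section DistanceToSet.
Context {R : realType} {V : normedModType R} (K : set V).
Hypothesis K_neq0 : K !=set0.

Let lbK y : has_lbound [set `|y - z| | z in K].
Proof. by exists 0 => _ [z _ <-]. Qed.

Let K0 y : [set `|y - z| | z in K] !=set0.
Proof. by have [z Kz] := K_neq0; exists `|y - z|, z. Qed.

Lemma dist_to_ge0 y : 0 <= dist_to K y.
Proof. by apply: lb_le_inf => // _ [z _ <-]. Qed.

Lemma dist_to_le y z : K z -> dist_to K y <= `|y - z|.
Proof. by move=> Kz; apply: ge_inf => //; exists z. Qed.

Lemma dist_to_lt_ex y d : dist_to K y < d -> exists2 z, K z & `|y - z| < d.
Proof. by move=> /(inf_lt (K0 y))[_ [z Kz <-] zd]; exists z. Qed.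

Lemma dist_to0 y : K y -> dist_to K y = 0.
Proof.
move=> Ky; apply/eqP; rewrite eq_le dist_to_ge0 andbT.
by rewrite (le_trans (dist_to_le y Ky))// subrr normr0.
Qed.

Lemma dist_to_lip y z : dist_to K y <= dist_to K z + `|y - z|.
Proof.
rewrite -lerBlDr; apply: lb_le_inf => // _ [w Kw <-].
by rewrite lerBlDr (le_trans (dist_to_le y Kw))// [leRHS]addrC ler_distD.
Qed.

Lemma dist_to_continuous : continuous (dist_to K : V -> R).
Proof.
move=> y; apply/cvgrPdist_lt => e e0; near=> z.
have zy : `|y - z| < e by near: z; exact: (@cvgr_dist_lt _ _ _ (nbhs y)).
rewrite ltr_norml; have := dist_to_lip y z; have := dist_to_lip z y.
rewrite distrC => h1 h2; apply/andP; split; lra.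
Unshelve. all: by end_near. Qed.

Lemma dist_to_convex t y z : convex_set K -> 0 <= t -> t <= 1 ->
  dist_to K (t *: y + (1 - t) *: z) <= t * dist_to K y + (1 - t) * dist_to K z.
Proof.
move=> /convex_setP cK t0 t1; apply/ler_addgt0Pr => e e0.
have [y' Ky' yy'] : exists2 y', K y' & `|y - y'| < dist_to K y + e.
  by apply: dist_to_lt_ex; rewrite ltrDl.
have [z' Kz' zz'] : exists2 z', K z' & `|z - z'| < dist_to K z + e.
  by apply: dist_to_lt_ex; rewrite ltrDl.
rewrite (le_trans (dist_to_le _ (cK _ _ _ t0 t1 Ky' Kz')))//.
rewrite opprD -!scalerN -scale_convD (le_trans (ler_normD _ _))// !normrZ.
by rewrite !ger0_norm ?subr_ge0//; rewrite -subr_ge0 in t1; nra.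
Qed.

End DistanceToSet.

(** * Multipliers from Fenchel duality *)

Section MultiplierRule.
Context {R : realType} {X Y : normedModType R}.

(* Fenchel duality for [z |-> A (z - x) + eta |z - x| + k d_K(y0 + T (z - x))]
   on [C], with perturbations [a] and [b] of the two norm terms. *)
Lemma multiplier_rule (C : set X) (K : set Y) (A : dual_space X) (T : clin X Y)
    (x : X) (y0 : Y) (eta k : R) :
  convex_set C -> C x -> convex_set K -> K !=set0 -> 0 <= eta -> 0 <= k ->
  (forall z, C z -> 0 <= A (z - x) + eta * `|z - x| +
     k * (dist_to K (y0 + T (z - x)) - dist_to K y0)) ->
  exists (l : dual_space Y) (mu : dual_space X),
    [/\ normal_cone C x mu, forall y, K y -> l (y - y0) <= 0 &
        `|A + (adjoint T l + mu)| <= eta].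
Proof.
move=> /convex_setP cC Cx /convex_setP cK K0 eta0 k0 opt.
pose d0 := dist_to K y0.
(* Writing the distance as an infimum over [y] in [K] makes the perturbed value jointly convex in
   [z], [y] and the perturbations. *)
pose S (ab : X * Y) (r : R) := exists z y, [/\ C z, K y &
  A (z - x) + eta * `|z - x + ab.1| +
  k * (`|y0 + T (z - x) - y + ab.2| - d0) <= r].
have [|||L LS] := @hahn_banach_convex R (X * Y)%type S.
- move=> t [a1 b1] r1 [a2 b2] r2 t0 t1 [z1 [y1 [Cz1 Ky1 le1]]] [z2 [y2 [Cz2 Ky2 le2]]].
  exists (t *: z1 + (1 - t) *: z2), (t *: y1 + (1 - t) *: y2).
  split; [exact: cC|exact: cK|move=> /=].
  have E : t *: z1 + (1 - t) *: z2 - x = t *: (z1 - x) + (1 - t) *: (z2 - x).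
    by rewrite scale_convD scale_convv.
  have EA : A (t *: z1 + (1 - t) *: z2 - x) =
      t * (A (z1 - x) : R) + (1 - t) * A (z2 - x).
    by rewrite E linearD !linearZ.
  have Ea : t *: z1 + (1 - t) *: z2 - x + (t *: a1 + (1 - t) *: a2) =
      t *: (z1 - x + a1) + (1 - t) *: (z2 - x + a2) by rewrite scale_convD E.
  have Eb : y0 + T (t *: z1 + (1 - t) *: z2 - x) - (t *: y1 + (1 - t) *: y2) +
        (t *: b1 + (1 - t) *: b2) =
      t *: (y0 + T (z1 - x) - y1 + b1) + (1 - t) *: (y0 + T (z2 - x) - y2 + b2).
    by rewrite E linearD !linearZ/= !scale_convD scale_convv !scalerN -opprD.
  rewrite EA Ea Eb.
  have na := ler_normD (t *: (z1 - x + a1)) ((1 - t) *: (z2 - x + a2)).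
  have nb := ler_normD (t *: (y0 + T (z1 - x) - y1 + b1))
                       ((1 - t) *: (y0 + T (z2 - x) - y2 + b2)).
  rewrite !normrZ !ger0_norm ?subr_ge0// in na nb.
  rewrite -subr_ge0 in t1.
  have := ler_wpM2l eta0 na; have := ler_wpM2l k0 nb.
  have := ler_wpM2l t0 le1; have := ler_wpM2l t1 le2.
  rewrite /= ; lra.
- move=> [a b]; have [y Ky] := K0.
  by eexists; exists x, y; split.
- move=> r [z [y [Cz Ky /=]]]; apply: le_trans; rewrite !addr0.
  rewrite (le_trans (opt _ Cz))// lerD2l ler_wpM2l// lerD2r.
  exact: dist_to_le.
(* Take [z = x] and [y] nearly nearest to [y0]; [k + 1] keeps the divisor positive when [k = 0]. *)
have Lab a b : L (a, b) <= eta * `|a| + k * `|b|.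
  apply/ler_addgt0Pr => e e0.
  have k1 : 0 < k + 1 by rewrite ltr_wpDl.
  have [|y Ky yd] := @dist_to_lt_ex _ _ K K0 y0 (d0 + e / (k + 1)).
    by rewrite ltrDl divr_gt0.
  have : L (a, b) <= A (x - x) + eta * `|x - x + a| +
      k * (`|y0 + T (x - x) - y + b| - d0) by apply: LS; exists x, y.
  rewrite subrr !linear0 !add0r addr0 => /le_trans; apply.
  rewrite -[leRHS]addrA lerD2l.
  have := ler_wpM2l k0 (ler_normD (y0 - y) b).
  have : k * (e / (k + 1)) <= e.
    by rewrite mulrA ler_pdivrMr//; nra.
  by have := ler_wpM2l k0 (ltW yd); lra.
(* These perturbations cancel both norms. *)
have Lzy z y : C z -> K y ->
    L (- (z - x), - (y0 + T (z - x) - y)) <= A (z - x) - k * d0.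
  move=> Cz Ky; apply: LS; exists z, y; split => //=.
  by rewrite !subrr !normr0 mulr0 addr0 sub0r mulrN.
have lin_e : linear (fun a => L (a, 0) : R^o).
  by move=> c a a'; rewrite -linearP; congr (L (_, _)); rewrite /= scaler0 addr0.
have lin_l : linear (fun b => L (0, b) : R^o).
  by move=> c b b'; rewrite -linearP; congr (L (_, _)); rewrite /= scaler0 addr0.
pose me := GRing.isLinear.Build R X R^o *:%R _ lin_e.
pose ml := GRing.isLinear.Build R Y R^o *:%R _ lin_l.
pose fe : {linear X -> R^o} := HB.pack (fun a => L (a, 0) : R^o) me.
pose fl : {linear Y -> R^o} := HB.pack (fun b => L (0, b) : R^o) ml.
have [|e eE e_eta] := @clin_of_linear_le _ _ fe eta eta0.
  by move=> a; rewrite (le_trans (Lab a 0))// normr0 mulr0 addr0.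
have [|l lE l_k] := @clin_of_linear_le _ _ fl k k0.
  by move=> b; rewrite (le_trans (Lab 0 b))// normr0 mulr0 add0r.
have Lel a b : L (a, b) = (e a : R) + l b.
  have -> : (a, b) = (a, 0) + (0, b) by congr pair; rewrite /= ?addr0 ?add0r.
  by rewrite eE lE linearD.
have lk b : l b <= k * `|b|.
  by rewrite lE (le_trans (Lab 0 b))// normr0 mulr0 add0r.
have d00 : 0 <= k * d0 by rewrite mulr_ge0// dist_to_ge0.
(* This choice makes the residual exactly [- e]. Normality comes from [Lzy] with [y] nearly nearest
   to [y0], the sign condition from [Lzy] with [z = x]. *)
exists l, (- (A + e + adjoint T l)); split.
- split => // z Cz; apply/ler_addgt0Pr => eps eps0.
  have k1 : 0 < k + 1 by rewrite ltr_wpDl.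
  have [|y Ky yd] := @dist_to_lt_ex _ _ K K0 y0 (d0 + eps / (k + 1)).
    by rewrite ltrDl divr_gt0.
  have : k * (eps / (k + 1)) <= eps.
    by rewrite mulrA ler_pdivrMr//; nra.
  have := Lzy _ _ Cz Ky; rewrite Lel !dualN.
  have -> : l (y0 + T (z - x) - y) = (l (T (z - x)) : R) + l (y0 - y).
    by rewrite addrAC addrC linearD.
  have := lk (y0 - y); have := ler_wpM2l k0 (ltW yd).
  rewrite add0r -[X in _ -> _ -> _ -> _ -> X <= _]/(- (A (z - x) + e (z - x) + l (T (z - x))) : R).
  lra.
- move=> y Ky; have := Lzy _ _ Cx Ky.
  rewrite subrr !linear0 addr0 opprB Lel linear0 !add0r => h.
  by rewrite (le_trans h)// oppr_le0.
- rewrite opprD [adjoint T l + _]addrC subrK opprD addrA subrr sub0r normrN.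
  exact: e_eta.
Qed.

End MultiplierRule.

(** * First-order condition for the penalized problem *)

Lemma frechet_expansion (R : realType) (V W : normedModType R) (G : V -> W)
    (x : V) (e : R) : differentiable G x -> 0 < e ->
  \forall y \near (0 : V), `|G (x + y) - G x - frechet G x y| <= e * `|y|.
Proof.
move=> dG e0; rewrite frechetE//.
have [_ /eqaddoP/(_ _ e0)] := (diff_locallyP x G).1 dG.
apply: filterS => y /=; rewrite !fctE/= [x + y]addrC.
by rewrite opprD addrA.
Qed.

(** Minimality is tested at [x + s *: h] with [h = z - x], and the result divided by [s]. The square
    then contributes at most [2 * |x - xb| * |h| + s * |h| ^+ 2]. *)
Lemma penalized_first_order (R : realType) (X Y : normedModType R)
    (f : X -> R^o) (G : X -> Y) (C : set X) (K : set Y) (xb x : X) (e k : R) :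
  differentiable f x -> differentiable G x ->
  convex_set C -> C x -> convex_set K -> K !=set0 -> 0 <= k ->
  (\forall z \near x, C z ->
     f x + `|x - xb| ^+ 2 + k * dist_to K (G x) <=
     f z + `|z - xb| ^+ 2 + k * dist_to K (G z) + e * `|z - x|) ->
  forall z, C z ->
    0 <= (frechet f x : dual_space X) (z - x) +
         (2 * `|x - xb| + e) * `|z - x| +
         k * (dist_to K (G x + frechet G x (z - x)) - dist_to K (G x)).
Proof.
move=> df dG cC Cx cK K0 k0 minx z Cz; apply/ler_addgt0Pr => eps eps0.
set h := z - x; set T := frechet G x; set A : dual_space X := frechet f x.
set d1 := dist_to K (G x + T h); set d0 := dist_to K (G x).
(* Linearization errors enter with weight 1 for [f] and [k] for [G]; [e1] keeps their sum at most
   [s * (eps / 2)]. The other half of [eps] absorbs [s * |h| ^+ 2]. *)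
pose e1 := eps / 2 / ((1 + k) * (`|h| + 1)).
have h1 : 0 < `|h| + 1 by rewrite ltr_wpDl.
have k1 : 0 < 1 + k by rewrite ltr_pwDl.
have e10 : 0 < e1 by rewrite !divr_gt0// mulr_gt0.
have e1h : e1 * `|h| * (1 + k) <= eps / 2.
  have : e1 * ((1 + k) * (`|h| + 1)) = eps / 2.
    by rewrite /e1 divfK// gt_eqF// mulr_gt0.
  have : 0 <= e1 * (1 + k) by rewrite mulr_ge0// ltW.
  by lra.
have /nbhs_ballP[r1 /= r10 fr] := frechet_expansion df e10.
have /nbhs_ballP[r2 /= r20 Gr] := frechet_expansion dG e10.
have /nbhs_ballP[r3 /= r30 mr] := minx.
near (0 : R)^'+ => s.
have s0 : 0 < s by near: s; exact: nbhs_right_gt.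
have s1 : s < 1 by near: s; exact: nbhs_right_lt.
have sr r : s < r / (`|h| + 1) -> `|s *: h| < r.
  move=> sr; rewrite normrZ gtr0_norm//.
  by move: sr; rewrite ltr_pdivlMr//; nra.
have sr1 : `|s *: h| < r1.
  by apply: sr; near: s; apply: nbhs_right_lt; rewrite divr_gt0.
have sr2 : `|s *: h| < r2.
  by apply: sr; near: s; apply: nbhs_right_lt; rewrite divr_gt0.
have sr3 : `|s *: h| < r3.
  by apply: sr; near: s; apply: nbhs_right_lt; rewrite divr_gt0.
have hh1 : 0 < `|h| ^+ 2 + 1 by rewrite ltr_wpDl// sqr_ge0.
have sh2 : s * `|h| ^+ 2 <= eps / 2.
  have : s < eps / 2 / (`|h| ^+ 2 + 1).
    by near: s; apply: nbhs_right_lt; rewrite !divr_gt0.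
  by rewrite ltr_pdivlMr//; nra.
have ball0 r y : `|y| < r -> ball (0 : X) r y.
  by move=> yr; rewrite -ball_normE/= sub0r normrN.
have F1 := fr _ (ball0 _ _ sr1); have F2 := Gr _ (ball0 _ _ sr2).
have Csh : C (x + s *: h).
  by rewrite /h -scale_conv_sub; apply: (convex_setP cC); rewrite // ltW.
have F3 : f x + `|x - xb| ^+ 2 + k * d0 <=
    f (x + s *: h) + `|x + s *: h - xb| ^+ 2 +
    k * dist_to K (G (x + s *: h)) + e * `|s *: h|.
  have -> : `|s *: h| = `|x + s *: h - x| by rewrite addrAC subrr add0r.
  apply: mr Csh; rewrite -ball_normE/= opprD addrA subrr sub0r normrN.
  exact: sr3.
have nsh : `|s *: h| = s * `|h| by rewrite normrZ gtr0_norm.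
have F4 : `|x + s *: h - xb| ^+ 2 <= (`|x - xb| + s * `|h|) ^+ 2.
  rewrite ler_sqr ?nnegrE ?addr_ge0 ?mulr_ge0 ?(ltW s0)//.
  by rewrite -nsh addrAC ler_normD.
(* Convexity of the distance limits its growth along the linearization to [s * (d1 - d0)]. *)
have F5 : dist_to K (G x + s *: T h) <= s * d1 + (1 - s) * d0.
  have -> : G x + s *: T h = s *: (G x + T h) + (1 - s) *: G x.
    by rewrite scale_conv_sub addrAC subrr add0r.
  by apply: dist_to_convex => //; exact: ltW.
have F6 := dist_to_lip K0 (G (x + s *: h)) (G x + s *: T h).
have F7 : `|G (x + s *: h) - (G x + s *: T h)| <= e1 * (s * `|h|).
  by rewrite -nsh opprD addrA -[s *: T h]linearZ.
have F8 : f (x + s *: h) <= f x + s * (A h : R) + e1 * (s * `|h|).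
  have As : A (s *: h) = s * (A h : R) by rewrite linearZ.
  have : (f (x + s *: h) - f x - A (s *: h) : R) <= e1 * `|s *: h|.
    exact: le_trans (ler_norm _) F1.
  by rewrite As nsh; lra.
have F9 := ler_wpM2l k0 (le_trans F6 (lerD F5 F7)).
rewrite nsh in F3.
rewrite -(pmulr_rge0 _ s0).
have := ler_wpM2l (ltW s0) sh2; have := ler_wpM2l (ltW s0) e1h.
rewrite !expr2 in F3 F4 *.
lra.
Unshelve. all: by end_near. Qed.

(** * Approximate KKT points *)

Lemma weakly_seq_lsc_le (R : realType) (V : normedModType R) (f : V -> R^o)
    (u : V^nat) (x : V) (c : R) :
  weakly_seq_lsc f -> weak_cvg u x -> (\forall k \near \oo, f (u k) <= c) ->
  f x <= c.
Proof.
move=> lscf ux uc; rewrite -lee_fin; apply: le_trans (lscf _ _ ux) _.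
rewrite limn_einf_lim; apply: lime_le; first exact: is_cvg_einfs.
apply: filterS uc => k uc; apply: (@le_trans _ _ (f (u k))%:E).
  by apply: ereal_inf_lbound; exists k => /=.
by rewrite lee_fin.
Qed.

(** Values below every [- n] would, along a weakly convergent reindexing, force [f x <= - n] for all
    [n]. This supplies the lower bound for Ekeland's principle. *)
Lemma reflexive_lsc_bounded_below (R : realType) (V : normedModType R)
    (D : set V) (f : V -> R^o) (M : R) :
  reflexive_space V -> (forall x, D x -> `|x| <= M) -> weakly_seq_lsc f ->
  exists m : R, forall x, D x -> m <= f x.
Proof.
move=> reflV DM lscf; apply: contrapT => nm.
have /choice[u uP] (n : nat) : exists x, D x /\ f x < - n%:R.
  apply: contrapT => nx; apply: nm; exists (- n%:R) => x Dx.
  by rewrite leNgt; apply/negP => fx; apply: nx; exists x.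
have uM n : `|u n| <= M by apply: DM; case: (uP n).
have [x [phi [phik ux]]] := reflexive_weak_seq_compact reflV uM.
have fx n : f x <= - n%:R.
  apply: (weakly_seq_lsc_le lscf ux); exists n => // k /= nk.
  have [_ /ltW/le_trans] := uP (phi k); apply.
  by rewrite lerN2 ler_nat (leq_trans nk).
have := fx (Num.truncn `|f x|).+1; rewrite leNgt => /negP; apply.
rewrite ltrNl (le_lt_trans (ler_norm _))// normrN.
by have := truncnS_gt `|f x|.
Qed.

Lemma weak_cvg_strong (R : realType) (V : normedModType R) (u : V^nat) x :
  u @ \oo --> x -> weak_cvg u x.
Proof.
by move=> ux v; apply: continuous_cvg => //; exact: clin_continuous.
Qed.

Lemma weak_star_cvg_strong (R : realType) (V : normedModType R)
    (v : (dual_space V)^nat) (l : dual_space V) :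
  v @ \oo --> l -> weak_star_cvg v l.
Proof.
move=> /cvgrPdist_lt vl x; apply/cvgrPdist_lt => e e0.
have x1 : 0 < `|x| + 1 by rewrite ltr_wpDl.
have : 0 < e / (`|x| + 1) by rewrite divr_gt0.
move=> /vl; apply: filterS => k; rewrite ltr_pdivlMr//.
have lv : `|(l x : R) - v k x| <= `|l - v k| * `|x| := clin_norm_le (l - v k) x.
by have := normr_ge0 (l - v k); lra.
Qed.

(** Strong convergence implies weak and weak-star convergence, so s-AKKT regularity quantifies over
    the fewest sequences. *)
Lemma AKKT_regular_s (R : realType) (X Y : normedModType R) (G : X -> Y)
    (C : set X) (K : set Y) (x : X) :
  w_AKKT_regular G C K x \/ sw_AKKT_regular G C K x \/
    s_AKKT_regular G C K x ->
  s_AKKT_regular G C K x.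
Proof.
move=> [[Fx wx]|[[Fx swx]|//]]; split=> // vbar xs r v xsx r0 rr vv M.
- apply: (wx vbar xs r v) => //; first exact: weak_cvg_strong.
  exact: weak_star_cvg_strong.
- by apply: (swx vbar xs r v) => //; exact: weak_star_cvg_strong.
Qed.

(** The final estimate spends a quarter of [eta] on each of three errors: the change of [frechet f]
    from [xb] to [x], the Ekeland term, and the slope of the squared norm. *)
Lemma approximate_KKT (R : realType) (X Y : completeNormedModType R)
    (G : X -> Y) (C : set X) (K : set Y) (f : X -> R^o) (xb : X) (eta : R) :
  continuously_differentiable G ->
  closed C -> convex_set C -> K !=set0 -> convex_set K -> reflexive_space X ->
  (forall (xs : X^nat) (x : X), (forall k, C (xs k)) -> C x -> weak_cvg xs x ->
     dist_to K (G (xs k)) @[k --> \oo] --> (0 : R) -> K (G x)) ->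
  continuously_differentiable f -> weakly_seq_lsc f ->
  local_minimizer f G C K xb -> 0 < eta ->
  exists (x : X) (l : dual_space Y) (mu : dual_space X),
    [/\ `|xb - x| < eta, normal_cone C x mu,
        forall y, K y -> l (y - G x) <= 0 &
        `|(frechet f xb : dual_space X) + (adjoint (frechet G x) l + mu)| < eta].
Proof.
move=> [dG _] clC cC K0 cK reflX wsc [df cdf] lscf [[Cxb Kxb] minxb] eta0.
have [rho rho0 rhoP] : exists2 rho : R, 0 < rho & forall z, `|z - xb| <= rho ->
    C z -> K (G z) -> f xb <= f z.
  have /nbhs_ballP[r /= r0 rP] := minxb.
  exists (r / 2); first by rewrite divr_gt0.
  move=> z zr Cz Kz; apply: rP => //; rewrite -ball_normE/= distrC; lra.
have [r r0 rP] : exists2 r : R, 0 < r & forall z, `|z - xb| < r ->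
    `|(frechet f xb : dual_space X) - frechet f z| < eta / 4.
  have /cvgrPdist_lt/(_ (eta / 4)) := cdf xb.
  rewrite divr_gt0// => /(_ isT)/nbhs_ballP[r /= r0 rP].
  by exists r => // z zr; apply: rP; rewrite -ball_normE/= distrC.
pose D := [set z | C z /\ `|z - xb| <= rho].
have DM z : D z -> `|z| <= `|xb| + rho.
  move=> [_ zr]; rewrite -[z in leLHS](subrK xb) addrC.
  by rewrite (le_trans (ler_normD _ _))// lerD2l.
have clD : closed D.
  apply: (@closedI _ C ((fun z => `|z - xb|) @^-1` [set y : R | y <= rho])) => //.
  apply: preimage_closed; last exact: closed_le.
  by move=> z _; apply: cvg_norm; apply: cvgB; [exact: cvg_id|exact: cvg_cst].
have cD t y z : 0 <= t -> t <= 1 -> D y -> D z -> D (t *: y + (1 - t) *: z).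
  move=> t0 t1 [Cy yr] [Cz zr]; split; first exact: (convex_setP cC).
  rewrite -[X in _ - X](scale_convv t) opprD -!scalerN -scale_convD.
  rewrite (le_trans (ler_normD _ _))// !normrZ !ger0_norm ?subr_ge0//.
  by rewrite -subr_ge0 in t1; nra.
have [m mP] := reflexive_lsc_bounded_below reflX DM lscf.
pose phi (k : nat) z := f z + `|z - xb| ^+ 2 + k.+1%:R * dist_to K (G z).
have d_ge0 z : 0 <= dist_to K (G z) := dist_to_ge0 K0 _.
have dk_ge0 (k : nat) z : 0 <= k.+1%:R * dist_to K (G z) by rewrite mulr_ge0.
have Dxb : D xb by split => //; rewrite subrr normr0 ltW.
have phixb k : phi k xb = f xb.
  by rewrite /phi subrr normr0 expr0n/= (dist_to0 K0 Kxb) mulr0 !addr0.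
have cphi k : continuous (phi k : X -> R).
  move=> z; apply: cvgD; first apply: cvgD.
  - exact: (differentiable_continuous (df z)).
  - under eq_fun do rewrite expr2.
    have nz : `|y - xb| @[y --> z] --> `|z - xb|.
      by apply: cvg_norm; apply: cvgB; [exact: cvg_id|exact: cvg_cst].
    by rewrite expr2; exact: cvgM.
  - apply: cvgM; first exact: cvg_cst.
    apply: (@continuous_comp _ _ _ G (dist_to K)).
      exact: (differentiable_continuous (dG z)).
    exact: dist_to_continuous.
have eta40 : 0 < eta / 4 by rewrite divr_gt0.
have /choice[u uP] (k : nat) : exists x, [/\ D x,
    phi k x + eta / 4 * `|x - xb| <= phi k xb &
    forall y, D y -> phi k x <= phi k y + eta / 4 * `|y - x|].
  apply: (@ekeland _ _ D (phi k) xb (eta / 4) m) => // z Dz.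
  rewrite /phi -addrA (le_trans (mP z Dz))// lerDl.
  by rewrite addr_ge0 ?sqr_ge0.
have Du k : D (u k) by case: (uP k).
(* [rho] puts [x] in the interior of the ball, so minimality over [D] is local minimality over [C];
   [r] controls [frechet f]; [eta / 8] makes [2 * |x - xb|] less than [eta / 4]. *)
pose d := Num.min (Num.min rho r) (eta / 8).
have d0 : 0 < d by rewrite !lt_min rho0 r0 divr_gt0.
have [k ukd] : exists k, `|u k - xb| < d.
  (* Otherwise every [u k] pays at least [d ^+ 2] in the squared norm; a weak limit would be
     feasible, within the ball, and satisfy [f x <= f xb - d ^+ 2], against local minimality. *)
  apply: contrapT => nk.
  have dk k : d <= `|u k - xb|.
    by rewrite leNgt; apply/negP => ?; apply: nk; exists k.
  have uM n : `|u n| <= `|xb| + rho by exact: DM.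
  have [x [psi [psik ux]]] := reflexive_weak_seq_compact reflX uM.
  have pen k : f (u k) + d ^+ 2 + k.+1%:R * dist_to K (G (u k)) <= f xb.
    have [_ + _] := uP k; rewrite phixb /phi.
    have : d ^+ 2 <= `|u k - xb| ^+ 2 by rewrite ler_sqr ?nnegrE ?(ltW d0).
    have : 0 <= eta / 4 * `|u k - xb| by rewrite mulr_ge0// ltW.
    lra.
  have Dx : D x.
    by apply: (closed_convex_weakly_tends cD clD _ (fun k => Du (psi k))) ux.
  have Kx : K (G x).
    apply: (wsc (u \o psi)) => //; [by move=> k; case: (Du (psi k))|by case: Dx|].
    apply/cvgrPdist_lt => e e0.
    pose c := f xb - m + 1.
    have c0 : 0 < c by rewrite ltr_wpDl// subr_ge0 mP.
    near=> k.
    have kc : k.+1%:R^-1 < e / c.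
      near: k; apply: (near_infty_natSinv_lt (PosNum _)).
      exact: divr_gt0.
    rewrite sub0r normrN ger0_norm//=.
    have : (psi k).+1%:R * dist_to K (G (u (psi k))) <= c.
      by have := pen (psi k); have := mP _ (Du (psi k)); have := sqr_ge0 d;
         rewrite /c; lra.
    (* Since [k <= psi k], the penalty weight may be lowered to [k.+1], which bounds the distance by
       [c / k.+1]. *)
    have : k.+1%:R * dist_to K (G (u (psi k))) <=
           (psi k).+1%:R * dist_to K (G (u (psi k))).
      by rewrite ler_wpM2r// ler_nat ltnS.
    move=> /le_trans/[apply]; rewrite -ler_pdivlMl//.
    move=> /le_lt_trans; apply; rewrite -ltr_pdivlMr//.
  have [Cx xr] := Dx.
  have := rhoP x xr Cx Kx.
  have : f x <= f xb - d ^+ 2.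
    apply: (weakly_seq_lsc_le lscf ux); apply: nearW => k /=.
    by have := pen (psi k); have := dk_ge0 (psi k) (u (psi k)); lra.
  have : 0 < d ^+ 2 by rewrite exprn_gt0.
  lra.
have [Dx _ ekx] := uP k; set x := u k in ukd Dx ekx.
have [Cx _] := Dx.
move: ukd; rewrite !lt_min => /andP[/andP[xrho xr] xeta].
have minx : \forall z \near x, C z ->
     f x + `|x - xb| ^+ 2 + k.+1%:R * dist_to K (G x) <=
     f z + `|z - xb| ^+ 2 + k.+1%:R * dist_to K (G z) + eta / 4 * `|z - x|.
  have gap : 0 < rho - `|x - xb| by rewrite subr_gt0.
  apply/nbhs_ballP; exists (rho - `|x - xb|) => //= z.
  rewrite -ball_normE/= distrC => zx Cz; apply: ekx; split => //.
  by rewrite (le_trans (ler_distD x _ _))//; lra.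
have k0 : 0 <= k.+1%:R :> R by [].
have foc := penalized_first_order (df x) (dG x) cC Cx cK K0 k0 minx.
have et0 : 0 <= 2 * `|x - xb| + eta / 4 by rewrite addr_ge0 ?mulr_ge0// ltW.
have [l [mu [Nmu lK lmu]]] := multiplier_rule cC Cx cK K0 et0 k0 foc.
exists x, l, mu; split => //; first by rewrite distrC; lra.
move: (adjoint _ _ + mu) lmu => w lmu.
have -> : (frechet f xb : dual_space X) + w =
    ((frechet f xb : dual_space X) - frechet f x) + ((frechet f x : dual_space X) + w).
  by rewrite [RHS]addrA subrK.
rewrite (le_lt_trans (ler_normD _ _))//.
by have := rP _ xr; lra.
Unshelve. all: by end_near. Qed.

Theorem corollary4p8 (R : realType) (X Y : completeNormedModType R)
    (G : X -> Y) (C : set X) (K : set Y)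
    (G_C1 : continuously_differentiable G)
    (C_neq0 : C !=set0) (C_closed : closed C) (C_convex : convex_set C)
    (K_neq0 : K !=set0) (K_closed : closed K) (K_convex : convex_set K)
    (X_reflexive : reflexive_space X)
    (weak_seq_closed : forall (xs : X^nat) (x : X),
      (forall k, C (xs k)) -> C x ->
      weak_cvg xs x -> dist_to K (G (xs k)) @[k --> \oo] --> (0 : R) ->
      K (G x)) :
  forall xbar : X, feasible G C K xbar ->
    w_AKKT_regular G C K xbar \/ sw_AKKT_regular G C K xbar \/
      s_AKKT_regular G C K xbar ->
    forall f : X -> R^o,
      continuously_differentiable f -> weakly_seq_lsc f ->
      local_minimizer f G C K xbar -> KKT_point f G C K xbar.
Proof.
move=> xb Fxb /AKKT_regular_s[_ sreg] f f_C1 lscf minxb.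
have inv_gt0 (k : nat) : 0 < k.+1%:R^-1 :> R by rewrite invr_gt0.
have /choice[xs] (k : nat) := approximate_KKT G_C1 C_closed C_convex K_neq0
  K_convex X_reflexive weak_seq_closed f_C1 lscf minxb (inv_gt0 k).
move=> /choice[ls] /choice[ms] msP.
pose v k : dual_space X := adjoint (frechet G (xs k)) (ls k) + ms k.
(* With tolerance [k.+1%:R^-1] at stage [k], [xs] tends to [xb] and [v] to [- frechet f xb];
   regularity applies with [r] constantly 0. *)
have [l [mu [Nmu lK E]]] : Mset G C K xb 0 (- (frechet f xb : dual_space X)).
  apply: (sreg _ xs (cst 0) v) => //.
  - apply/cvgrPdist_lt => e e0; near=> k.
    case: (msP k) => [xk _ _ _]; apply: (lt_trans xk).
    near: k; exact: near_infty_natSinv_lt (PosNum e0).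
  - exact: cvg_cst.
  - apply/cvgrPdist_lt => e e0; near=> k.
    rewrite -opprD normrN; case: (msP k) => [_ _ _ vk]; apply: (lt_trans vk).
    near: k; exact: near_infty_natSinv_lt (PosNum e0).
  - by move=> k; exists (ls k), (ms k); case: (msP k).
(* Subtracting the adjoint term leaves exactly [mu], which is normal to [C]. *)
split => //; exists l; split; first by rewrite E [X in X - _]addrC addrK.
by case: Fxb.
Unshelve. all: by end_near. Qed.
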